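(* Let $M>N\ge 3$ be integers, $1\le v\le M-N$, and let $D$ be a digraph on $\{1,\dots,M\}$ produced by the construction process described in the context, with cycle adjacency sets $C_i$ ($v+1<i\le v+N$). Then $D$ is invertible if and only if $N$ is even or $C_i=\{i-1\}$ for all $v+1<i<v+N$.
   Context: A ''partition of $M$ into $M$ parts'' means an ordered sequence $(t_1,\dots,t_M)$ of non-negative integers with sum $M$. A Motzkin partition of $N$ is an ordered sequence of $N$ integers in $\{0,1,2\}$ with sum $N$, such that for all $1\le i<N$ the sum of the first $i$ entries is less than $i$. Construction process: let $P=\{p_{v+1},\dots,p_{v+N}\}$ be a Motzkin partition of $N$ (indexed by $v+1,\dots,v+N$) and $T=\{t_1,\dots,t_M\}$ a partition of $M$ into $M$ parts such that $t_i\ge p_i$ for $v+1\le i\le v+N$, $\sum_{k=1}^i t_k\le i$ for all $i$, and $\sum_{k=1}^i t_k<i$ for $1\le i<v+N$. Set $q_i=t_i-p_i$ for $v+1\le i\le v+N$ and $q_i=t_i$ otherwise. Choose sets $C_i\subseteq\{v+1,\dots,i-1\}$ with $|C_i|=p_i$ for $v+1<i\le v+N$ such that the directed edges $c\to i$ ($c\in C_i$, $v+1<i\le v+N$) form, as an undirected graph, the cycle graph on the vertices $\{v+1,\dots,v+N\}$; put $C_i=\emptyset$ for the other $i$. Starting from the graph $H_1$ on $\{1,\dots,M\}$ with exactly these edges, for $i=2,\dots,M$ successively choose a set $R_i\subseteq\{1,\dots,i-1\}$ with $|R_i|=q_i$, disjoint from $C_i$, such that the graph $H_i$ obtained from $H_{i-1}$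 by adding the edges $s\to i$, $s\in R_i$, is still unicyclic as an undirected graph (its only cycle being the one on $\{v+1,\dots,v+N\}$). With $S_i=R_i\cup C_i$, the resulting digraph $D=H_M$ has the edges $s\to i$ for $s\in S_i$, $1<i\le M$. Let $B$ be the $M\times M$ upper unitriangular matrix with $B_{i,i}=1$ and $B_{i,j}$ the number of edges $i\to j$ of $D$ for $i\ne j$. $D$ is invertible if there is a diagonal matrix $S$ with diagonal entries in $\{\pm1\}$ such that $SB^{-1}S=|B^{-1}|$, where $|\cdot|$ is the componentwise absolute value. *)

(* Defs.v *)
From HB Require Import structures.
From mathcomp Require Import all_boot all_order all_algebra.

Set Implicit Arguments.
Unset Strict Implicit.
Unset Printing Implicit Defensive.

Import GRing.Theory Num.Theory.

Local Open Scope nat_scope.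

(* Sequences are indexed from 1: [entry s k] is $s_k$ (for k >= 1), and
   [psum s i] is $s_1 + ... + s_i$. *)
Definition entry (s : seq nat) (k : nat) : nat := nth 0 s k.-1.
Definition psum (s : seq nat) (i : nat) : nat := sumn (take i s).

(* The vertex set {1, ..., M} is represented by 'I_M; [label x] is the number,
   between 1 and M, of the vertex x. *)
Definition label (M : nat) (x : 'I_M) : nat := x.+1.

Definition is_partition (M : nat) (t : seq nat) : Prop :=
  size t = M /\ sumn t = M.

Definition is_Motzkin_partition (N : nat) (p : seq nat) : Prop :=
  [/\ size p = N,
      all (fun a => a <= 2) p,
      sumn p = N &
      forall i, 1 <= i < N -> psum p i < i].

Section Graphs.
Variable T : finType.
Implicit Types (d e : rel T) (c : seq T) (W : {set T}).

(* A digraph on T is a rel T, [d x y] meaning that there is an edge x -> y. *)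
Definition undirected d : rel T := [rel x y | d x y || d y x].

Definition cycle_edges c : {set {set T}} := [set [set x; next c x] | x in c].

Definition is_cycle e c : Prop := [/\ cycle e c, uniq c & 2 < size c].

(* Two sequences describe the same cycle when they have the same edge set;
   connectedness is not required. *)
Definition unicyclic e : Prop :=
  exists2 c, is_cycle e c &
    forall c', is_cycle e c' -> cycle_edges c' = cycle_edges c.

(* The edges of e are exactly those of a cycle with vertex set W (e may live on
   a larger type, the vertices outside W being isolated). *)
Definition is_cycle_graph_on e W : Prop :=
  exists c, [/\ is_cycle e c, c =i W &
    forall x y, e x y = ([set x; y] \in cycle_edges c)].

End Graphs.

Definition residual (N v : nat) (p t : seq nat) (i : nat) : nat :=
  if v.+1 <= i <= v + N then entry t i - entry p (i - v) else entry t i.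

Definition cycle_vertices (M N v : nat) : {set 'I_M} :=
  [set x : 'I_M | v.+1 <= label x <= v + N].

(* [C x] and [R x] are the sets of tails of the edges ending at x, so
   [digraph_H C R i s x] is the edge relation s -> x of $H_i$. *)
Definition digraph_H (M : nat) (C R : 'I_M -> {set 'I_M}) (i : nat) : rel 'I_M :=
  fun s x => (s \in C x) || ((1 < label x <= i) && (s \in R x)).

(* p stands for $(p_{v+1}, ..., p_{v+N})$: $p_i$ is [entry p (i - v)]. *)
Record construction (M N v : nat) (p t : seq nat) (C R : 'I_M -> {set 'I_M}) :
    Prop := Construction {
  constr_p : is_Motzkin_partition N p;
  constr_t : is_partition M t;
  constr_ge : forall i, v.+1 <= i <= v + N -> entry p (i - v) <= entry t i;
  constr_sum_le : forall i, 1 <= i <= M -> psum t i <= i;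
  constr_sum_lt : forall i, 1 <= i < v + N -> psum t i < i;
  constr_C_sub : forall x y : 'I_M, v.+1 < label x <= v + N ->
    y \in C x -> v.+1 <= label y < label x;
  constr_C_card : forall x : 'I_M, v.+1 < label x <= v + N ->
    #|C x| = entry p (label x - v);
  constr_C_out : forall x : 'I_M, ~~ (v.+1 < label x <= v + N) -> C x = set0;
  constr_C_cycle :
    is_cycle_graph_on (undirected (fun s x => s \in C x)) (cycle_vertices M N v);
  constr_R_sub : forall x y : 'I_M, 1 < label x ->
    y \in R x -> label y < label x;
  constr_R_card : forall x : 'I_M, 1 < label x ->
    #|R x| = residual N v p t (label x);
  constr_R_disj : forall x : 'I_M, 1 < label x -> [disjoint R x & C x];
  constr_unicyclic : forall i, 2 <= i <= M ->
    unicyclic (undirected (digraph_H C R i));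
  constr_only_cycle : forall i c, 2 <= i <= M ->
    is_cycle (undirected (digraph_H C R i)) c -> c =i cycle_vertices M N v
}.

Definition digraph_D (M : nat) (C R : 'I_M -> {set 'I_M}) : rel 'I_M :=
  digraph_H C R M.

Local Open Scope ring_scope.

Definition digraph_mx (M : nat) (d : rel 'I_M) : 'M[int]_M :=
  \matrix_(i, j) if i == j then 1 else (d i j)%:R.

Definition invertible_digraph (M : nat) (d : rel 'I_M) : Prop :=
  exists2 s : 'rV[int]_M, (forall i, s 0 i = 1 \/ s 0 i = -1) &
    diag_mx s *m invmx (digraph_mx d) *m diag_mx s
      = map_mx Num.norm (invmx (digraph_mx d)).

(* Main.v *)
Require Import Defs.
From mathcomp Require Import all_boot all_order all_algebra.
From mathcomp Require Import zify lra.

Import Order.TTheory GRing.Theory Num.Theory.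

(** Write X for the inverse of the matrix of D.  Since every edge goes from a
    smaller to a larger vertex, X is computed column by column by

      X i j = [i = j] - sum of X i k over the edges k -> j,

    and D is invertible exactly when the vertices carry signs s such that
    s i * X i j * s j is never negative.  A choice of signs is a 2-colouring, so
    the question is which 2-colourings are compatible with X.

    If N is even, D has no odd cycle, hence is bipartite, and the signs of a
    proper colouring turn the recurrence into one with nonnegative terms only
    (signed_inv_ge0_proper).

    If N is odd and the cycle is the chain v+1 -> v+2 -> ... -> v+N closed by the
    chord v+1 -> v+N, then D minus the chord has no cycle and is bipartite.  With
    the signs of a proper colouring of it, the chord is the only edge that
    contributes a negative term, namely minus the signed entry at v+1.  The
    signed entries do not decrease along the chain from v+1, so the other edge of
    the cycle that enters v+N compensates for it (signed_inv_ge0_chord).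

    Conversely, let N be odd and D invertible.  If X i j = -1 for all edges
    i -> j of the cycle, the signs alternate along an odd cycle, which is
    impossible.  So some edge i -> j of the cycle has X i j different from -1,
    and by the recurrence there is a second directed route from i to j
    (invmx_edge).  This route and the edge form a cycle whose vertices increase
    from i to j; it is the unique cycle of D, which is therefore the chain with
    its chord (two_routes_chain). *)

(** * Cycles and 2-colourings *)

Lemma undirected_sym (T : finType) (d : rel T) : symmetric (undirected d).
Proof. by move=> x y; rewrite /undirected /= orbC. Qed.

Lemma repeated_entry (T : eqType) (s : seq T) :
  ~~ uniq s -> exists x s1 s2 s3, s = s1 ++ x :: s2 ++ x :: s3.
Proof.
elim: s => [|x s IH] //=; rewrite negb_and negbK => /orP [xs|/IH].
  by case/splitPr: xs => s2 s3; exists x, [::], s2, s3.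
by case=> y [s1 [s2 [s3 ->]]]; exists y, (x :: s1), s2, s3.
Qed.

(** A closed walk that repeats a vertex splits there into two shorter closed
    walks, one of which is odd; irreflexivity excludes length 1 at the end. *)
Lemma odd_closed_walk (T : finType) (e : rel T) c :
  irreflexive e -> cycle e c -> odd (size c) ->
  exists2 c', is_cycle e c' & odd (size c').
Proof.
move=> irr_e; have [n] := ubnP (size c); elim: n c => // n IH c le_n cyc odd_c.
case Uc: (uniq c).
  exists c => //; split=> //.
  case: c cyc odd_c {le_n Uc} => [|x [|y [|z c]]] //=.
  by rewrite irr_e.
move/negbT: Uc => /repeated_entry [x [s1 [s2 [s3 eq_c]]]].
have cyc2 : cycle e (x :: s2 ++ x :: (s3 ++ s1)).
  by move: cyc; rewrite eq_c cycle_catC /= -catA /=.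
have size_c : size c = (size (x :: s2) + size (x :: s3 ++ s1))%N.
  by rewrite eq_c !size_cat /= !size_cat /=; lia.
have [cycA cycB] : cycle e (x :: s2) /\ cycle e (x :: s3 ++ s1).
  move: cyc2; rewrite /= rcons_cat cat_path /= => /and3P [pA lA pB].
  by split; rewrite // rcons_path pA lA.
case oA: (odd (size (x :: s2))).
  by apply: (IH (x :: s2)) => //; move: size_c le_n => /= ->; lia.
apply: (IH (x :: s3 ++ s1)) => //; first by move: size_c le_n => /= ->; lia.
by move: odd_c; rewrite size_c oddD oA.
Qed.

(** The bipartite double cover: walks in it record the parity of the length of
    their projection, so that parity becomes a matter of connectedness. *)
Definition double_cover (T : finType) (e : rel T) : rel (T * bool) :=
  [rel u w | e u.1 w.1 && (w.2 == ~~ u.2)].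

Lemma double_coverP (T : finType) (e : rel T) x a y b :
  connect (double_cover T e) (x, a) (y, b) <->
  exists p, [/\ path e x p, last x p = y & odd (size p) = a (+) b].
Proof.
split=> [/connectP [p]|[p []]].
  elim: p x a => [|[z c] p IH] x a /=.
    by move=> _ [-> ->]; exists [::]; rewrite addbb.
  case/andP=> /andP [/= exz /eqP ->] pp /(IH _ _ pp) [q [pq lq oq]].
  by exists (z :: q); rewrite /= exz pq lq oq addNb negbK.
elim: p x a => [|z p IH] x a /=.
  by move=> _ ->; case: a; case: b => // _; exact: connect0.
case/andP=> exz pp lp op.
have xz : connect (double_cover T e) (x, a) (z, ~~ a).
  by apply: connect1; rewrite /double_cover /= exz eqxx.
by apply: connect_trans xz (IH z (~~ a) pp lp _); rewrite addNb -op negbK.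
Qed.

(** The colour of x is the parity of the walks to x from a fixed vertex of its
    component.  It is well defined because walks of both parities would combine
    to an odd closed walk. *)
Lemma two_colouring (T : finType) (e : rel T) :
  irreflexive e -> symmetric e ->
  (forall c, is_cycle e c -> ~~ odd (size c)) ->
  exists f : T -> bool, forall x y, e x y -> f y = ~~ f x.
Proof.
move=> irr_e sym_e even_c.
have cs : connect_sym e by exact: sym_connect_sym.
have cs2 : connect_sym (double_cover T e).
  apply: sym_connect_sym => -[x a] [y b] /=.
  by rewrite /double_cover /= sym_e; case: a; case: b.
(* The two lifts of a vertex lie in different components of the cover. *)
have no_flip x : ~~ connect (double_cover T e) (x, false) (x, true).
  apply/negP => /double_coverP [p []].
  case/lastP: p => [|p z] // pp; rewrite last_rcons => zx.
  rewrite size_rcons => op; rewrite {z}zx in pp.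
  have [c cyc oc] := odd_closed_walk T e (x :: p) irr_e pp op.
  by have := even_c c cyc; rewrite oc.
exists (fun x => connect (double_cover T e) (fingraph.root e x, false) (x, false)).
move=> x y exy.
have -> : fingraph.root e y = fingraph.root e x.
  by apply/esym/(fingraph.rootP cs)/connect1.
set r := fingraph.root e x.
have xy a : connect (double_cover T e) (x, a) (y, ~~ a).
  by apply: connect1; rewrite /double_cover /= exy eqxx.
case fx: (connect _ _ (x, false)); case fy: (connect _ _ (y, false)) => //.
  (* (y, false), (r, false), (x, false), (y, true) are connected in this order. *)
  have := no_flip y; rewrite cs2 in fy.
  by rewrite (connect_trans fy (connect_trans fx (xy false))).
have : connect e r x by rewrite cs connect_root.
case/connectP=> p pp lp; case op: (odd (size p)).
  have rx : connect (double_cover T e) (r, false) (x, true).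
    by apply/double_coverP; exists p.
  by rewrite (connect_trans rx (xy true)) in fy.
have rx : connect (double_cover T e) (r, false) (x, false).
  by apply/double_coverP; exists p.
by rewrite rx in fx.
Qed.

Lemma alternating_cycle_even (T : eqType) (e : rel T) (f : T -> bool) c :
  (forall x y, e x y -> f y = ~~ f x) -> cycle e c -> ~~ odd (size c).
Proof.
move=> alt; have walk x p : path e x p -> f (last x p) = f x (+) odd (size p).
  elim: p x => [|y p IH] x /=; first by rewrite addbF.
  by case/andP=> /alt fy /IH ->; rewrite fy addNb addbN.
case: c => // x c /walk; rewrite last_rcons size_rcons => /=.
by case: (f x); case: (odd _).
Qed.

Lemma two_neighbours (T : finType) (e : rel T) c x :
  symmetric e -> is_cycle e c -> x \in c ->
  exists y z, [/\ y != z, e x y & e x z].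
Proof.
move=> sym_e [cyc Uc sz] /rot_to [i s rot_c].
move: cyc Uc sz; rewrite -(rot_cycle i) -(rot_uniq i) -(size_rot i) rot_c.
case: s {rot_c} => [|y s] //; case/lastP: s => [|s z] //=.
rewrite rcons_path last_rcons => /and3P [exy _ ezx] /and3P [_ yz _] _.
exists y, z; split=> //; last by rewrite sym_e.
by apply: contra yz => /eqP ->; rewrite mem_rcons mem_head.
Qed.

Lemma set2_eq (T : finType) (x y z w : T) :
  [set x; y] = [set z; w] -> (x = z /\ y = w) \/ (x = w /\ y = z).
Proof.
move=> E.
have: x \in [set z; w] by rewrite -E !inE eqxx.
have: y \in [set z; w] by rewrite -E !inE eqxx orbT.
have: z \in [set x; y] by rewrite E !inE eqxx.
have: w \in [set x; y] by rewrite E !inE eqxx orbT.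
by rewrite !inE; do 4![case/orP=> /eqP ?]; subst; auto.
Qed.

Lemma cycle_edges_sub (T : finType) (e : rel T) c x y :
  symmetric e -> cycle e c -> [set x; y] \in cycle_edges c -> e x y.
Proof.
move=> sym_e cyc /imsetP [w /(next_cycle cyc) ew].
by case/set2_eq=> [[-> ->]|[-> ->]] //; rewrite sym_e.
Qed.

Lemma next_iota v n k : v <= k < v + n ->
  next (iota v n) k = if k.+1 == v + n then v else k.+1.
Proof.
move=> /andP [vk kn]; case: n kn => [|n] kn; first lia.
have idx : index k (iota v n.+1) = k - v.
  have {1}-> : k = nth 0 (iota v n.+1) (k - v) by rewrite nth_iota; lia.
  by rewrite index_uniq ?iota_uniq ?size_iota //; lia.
rewrite next_nth mem_iota vk kn idx /=.
case: eqP => Ek; first by rewrite nth_default ?size_iota //; lia.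
by rewrite nth_iota; lia.
Qed.

(** * The inverse of the matrix of an increasing digraph *)

Section IncreasingDigraph.

Local Open Scope ring_scope.

Variables (M : nat) (d : rel 'I_M).
Hypothesis d_up : forall x y : 'I_M, d x y -> (x < y)%N.

Let X := invmx (digraph_mx d).

(** The matrix is unitriangular, because edges go upwards. *)
Lemma digraph_mx_unit : digraph_mx d \in unitmx.
Proof.
rewrite unitmxE -det_tr det_trig; last first.
  apply/is_trig_mxP => i j ij; rewrite !mxE; case: eqP => [ji|_].
    by move: ij; rewrite ji ltnn.
  by case dji: (d j i) => //; have := d_up _ _ dji; lia.
by rewrite big1 ?unitr1 // => i _; rewrite !mxE eqxx.
Qed.

(** The (i, j) entry of X *m digraph_mx d = 1. *)
Lemma invmx_rec i j :
  X i j = (i == j)%:R - \sum_(k | d k j) X i k.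
Proof.
move/matrixP/(_ i j): (mulVmx digraph_mx_unit).
rewrite !mxE => <-; rewrite (bigD1 j) //= mxE eqxx mulr1 -/X.
rewrite [X in _ + X - _](_ : _ = \sum_(k | d k j) X i k) ?addrK //.
rewrite big_mkcond [RHS]big_mkcond; apply: eq_bigr => k _ /=.
rewrite !mxE; case: eqP => [-> | _] /=.
  by case djj: (d j j) => //; have := d_up _ _ djj; rewrite ltnn.
by case: (d k j); rewrite ?mulr1 ?mulr0.
Qed.

Lemma connect_leq i j : connect d i j -> (i <= j)%N.
Proof.
case/connectP=> p; elim: p i => [|k p IH] i /=; first by move=> _ ->.
by case/andP=> /d_up ik /IH kj /kj; apply: leq_trans; apply: ltnW.
Qed.

Lemma invmx_connect i j : X i j != 0 -> connect d i j.
Proof.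
have [n] := ubnP j; elim: n j => // n IH j le_jn; rewrite invmx_rec.
case: (eqVneq i j) => [-> _|_]; first exact: connect0.
rewrite sub0r oppr_eq0 => nz.
have [k dkj Xk] : exists2 k, d k j & X i k != 0.
  apply/exists_inP; apply: contraNT nz.
  rewrite negb_exists_in => /forall_inP Z.
  by rewrite big1 // => k dkj; apply/eqP; have := Z k dkj; rewrite negbK.
apply: connect_trans (connect1 dkj); apply: IH => //.
by have := d_up _ _ dkj; lia.
Qed.

(** In the recurrence for X i j, the edge i -> j alone contributes - X i i = -1;
    any deviation from -1 comes from another in-neighbour k of j with a nonzero
    X i k, that is, from a second route from i to j. *)
Lemma invmx_edge i j : d i j -> X i j != -1 ->
  exists k, [/\ k != i, connect d i k & d k j].
Proof.
move=> dij; rewrite invmx_rec (bigD1 i) //=.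
have -> : (i == j) = false.
  by apply/eqP => ij; have := d_up _ _ dij; rewrite ij ltnn.
have -> : X i i = 1.
  rewrite invmx_rec eqxx big1 ?subr0 // => k dki; apply/eqP.
  apply: contraTT isT => /invmx_connect /connect_leq.
  by have := d_up _ _ dki; lia.
rewrite sub0r eqr_opp => nz.
have [k /andP [dkj ki] Xk] : exists2 k, d k j && (k != i) & X i k != 0.
  apply/exists_inP; apply: contraNT nz.
  rewrite negb_exists_in => /forall_inP Z.
  rewrite big1 ?addr0 // => k dkj; apply/eqP; have := Z k dkj.
  by rewrite negbK.
by exists k; split=> //; apply: invmx_connect.
Qed.

(** The entries of S X S, where S is the diagonal matrix whose signs are negative
    on the vertices coloured true; the two signs are merged into one. *)
Definition signed_inv (f : 'I_M -> bool) i j : int :=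
  (-1) ^+ (f i (+) f j) * X i j.

(** The sign of a term is positive when k and j have different colours: the minus
    sign of the recurrence for X is absorbed by the colouring. *)
Lemma signed_inv_rec f i j :
  signed_inv f i j =
    (i == j)%:R + \sum_(k | d k j) (-1) ^+ (f j (+) ~~ f k) * signed_inv f i k.
Proof.
rewrite /signed_inv invmx_rec mulrBr; congr (_ + _).
  by case: eqP => [->|_]; rewrite ?addbb ?mulr1 ?mulr0.
rewrite -mulNr mulr_sumr; apply: eq_bigr => k _; rewrite mulrA; congr (_ * _).
by case: (f i); case: (f j); case: (f k).
Qed.

Lemma invertible_of_signs f :
  (forall i j, 0 <= signed_inv f i j) -> invertible_digraph d.
Proof.
move=> ge0; exists (\row_i (-1) ^+ f i).
  by move=> i; rewrite mxE; case: (f i); [right | left].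
apply/matrixP => i j; rewrite mul_diag_mx mul_mx_diag !mxE -/X.
rewrite mulrAC -signr_addb -/(signed_inv f i j) -(ger0_norm (ge0 i j)).
by rewrite normrM normr_sign mul1r.
Qed.

(** At an entry equal to -1, the product of the two signs has to be -1. *)
Lemma invertible_signs :
  invertible_digraph d ->
  exists f : 'I_M -> bool, forall i j, X i j = -1 -> f j = ~~ f i.
Proof.
case=> s s1 E; exists (fun i => s 0 i == 1) => i j Xij.
move/matrixP/(_ i j): E; rewrite mul_diag_mx mul_mx_diag !mxE -/X Xij.
by case: (s1 i) => ->; case: (s1 j) => ->.
Qed.

Lemma signed_inv_ge0_proper f :
  (forall x y, d x y -> f y = ~~ f x) -> forall i j, 0 <= signed_inv f i j.
Proof.
move=> alt i j; have [n] := ubnP j; elim: n j => // n IH j le_jn.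
rewrite signed_inv_rec addr_ge0 ?ler0n // sumr_ge0 // => k dkj.
rewrite (alt _ _ dkj) addbb mul1r IH //; have := d_up _ _ dkj; lia.
Qed.

(** Here f may fail to alternate on the chord a -> b.  The proof is an induction
    on j that also carries the fact that the entries with j in [a, b) are at least
    the entry at a: every such j > a has an in-neighbour in [a, j).  At j = b, the
    in-neighbour strictly between a and b contributes at least the entry at a,
    which makes up for the possibly negative term of the chord. *)
Lemma signed_inv_ge0_chord f (a b : 'I_M) :
  (forall x y, d x y -> (x, y) != (a, b) -> f y = ~~ f x) ->
  (forall y : 'I_M, (a < y < b)%N -> exists2 x : 'I_M, d x y & (a <= x)%N) ->
  (exists2 x : 'I_M, d x b & (a < x)%N) ->
  forall i j, 0 <= signed_inv f i j.
Proof.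
move=> alt chain [y0 dy0 ay0] i.
have y0b := d_up _ _ dy0.
suff main j : 0 <= signed_inv f i j /\
    ((a <= j < b)%N -> signed_inv f i a <= signed_inv f i j).
  by move=> j; case: (main j).
have [n] := ubnP j; elim: n j => // n IH j le_jn.
have IHk k : d k j -> 0 <= signed_inv f i k /\
    ((a <= k < b)%N -> signed_inv f i a <= signed_inv f i k).
  by move=> dkj; apply: IH; have := d_up _ _ dkj; lia.
have [jb|jb] := eqVneq j b.
  split; last by rewrite jb ltnn andbF.
  subst j; rewrite signed_inv_rec addr_ge0 ?ler0n //.
  have term k : d k b -> k != a ->
      (-1) ^+ (f b (+) ~~ f k) * signed_inv f i k = signed_inv f i k.
    by move=> dkb ka; rewrite (alt k b) ?addbb ?mul1r // xpair_eqE negb_and ka.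
  have y0a : y0 != a by apply/eqP => E; move: ay0; rewrite E ltnn.
  rewrite (bigD1 y0) //= term //.
  have [ya _] := IHk _ dy0; have := (IHk _ dy0).2 _; rewrite (ltnW ay0) y0b.
  move=> /(_ isT) le_a.
  have [dab|dab] := boolP (d a b).
    rewrite (bigD1 a) /=; last by rewrite dab eq_sym y0a.
    have rest : 0 <= \sum_(k | d k b && (k != y0) && (k != a))
         (-1) ^+ (f b (+) ~~ f k) * signed_inv f i k.
      by apply: sumr_ge0 => k /andP [/andP [dkb _] ka];
         rewrite term //; case: (IHk _ dkb).
    have := (IHk _ dab).1; case: (f b (+) _); rewrite ?mul1r ?mulN1r; lra.
  rewrite addr_ge0 // sumr_ge0 // => k /andP [dkb _].
  rewrite term //; first by case: (IHk _ dkb).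
  by apply: contraNneq dab => <-.
have recj : signed_inv f i j = (i == j)%:R + \sum_(k | d k j) signed_inv f i k.
  rewrite signed_inv_rec; congr (_ + _); apply: eq_bigr => k dkj.
  by rewrite (alt k j) ?addbb ?mul1r // xpair_eqE negb_and jb orbT.
split; first by rewrite recj addr_ge0 ?ler0n ?sumr_ge0 // => k /IHk [].
case/andP=> aj j_b; have [->|ja] := eqVneq j a; first exact: lexx.
have [|k dkj ak] := chain j; first by move: ja; rewrite -val_eqE /=; lia.
have kj := d_up _ _ dkj.
have le_k : signed_inv f i a <= signed_inv f i k.
  by apply: (IHk _ dkj).2; lia.
apply: le_trans le_k _; rewrite recj (bigD1 k) //=.
rewrite addrCA lerDl addr_ge0 ?ler0n // sumr_ge0 // => l /andP [dlj _].
by case: (IHk _ dlj).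
Qed.

End IncreasingDigraph.

(** * The digraphs of the construction *)

Section Construction.

Variables (M N v : nat) (p t : seq nat) (C R : 'I_M -> {set 'I_M}).
Hypotheses (N_ge3 : 3 <= N) (vNM : v + N <= M).
Hypothesis hD : construction N v p t C R.

(* Vertices are shifted by one from their labels: the cycle lives on the vertices
   v, ..., v + N - 1 of 'I_M. *)
Let D := digraph_D C R.
Let K : rel 'I_M := undirected (fun s x => s \in C x).

Lemma C_edge (x y : 'I_M) : x \in C y -> [/\ v <= x, x < y & y < v + N].
Proof.
have [|/(constr_C_out hD) ->] := boolP (v.+1 < label y <= v + N); last first.
  by rewrite inE.
move=> /[dup] yW /(constr_C_sub hD) /[apply].
by rewrite /label in yW * => ?; split; lia.
Qed.

Lemma D_up (x y : 'I_M) : D x y -> x < y.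
Proof.
case/orP=> [/C_edge [] //|/andP [/andP [y1 _]] xR].
exact: constr_R_sub hD _ _ y1 xR.
Qed.

Lemma C_sub_D (x y : 'I_M) : x \in C y -> D x y.
Proof. by rewrite /D /digraph_D /digraph_H => ->. Qed.

Lemma K_sub_D : subrel K (undirected D).
Proof. by move=> x y /orP [] /C_sub_D xy; rewrite /undirected /= xy ?orbT. Qed.

Lemma D_irr : irreflexive (undirected D).
Proof.
by move=> x; apply/negP; rewrite /undirected /= orbb => /D_up; rewrite ltnn.
Qed.

(** The cycle of the sets C x is a cycle of D, and D has only one. *)
Lemma D_cycle c : is_cycle (undirected D) c ->
  c =i cycle_vertices M N v /\ forall x y, K x y = ([set x; y] \in cycle_edges c).
Proof.
have M2 : 2 <= M <= M by lia.
move=> cycc; split; first exact: constr_only_cycle hD _ _ M2 cycc.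
have [c0 [[cyc0 Uc0 sz0] _ Kc0]] := constr_C_cycle hD.
have [c1 _ uniq1] := constr_unicyclic hD M2.
have D0 : is_cycle (undirected D) c0.
  by split=> //; apply: sub_cycle cyc0; apply: K_sub_D.
by move=> x y; rewrite /K Kc0 (uniq1 _ D0) (uniq1 _ cycc).
Qed.

Lemma cycle_labels c : uniq c -> c =i cycle_vertices M N v ->
  perm_eq (map val c) (iota v N).
Proof.
move=> Uc Wc; apply: uniq_perm; rewrite ?(map_inj_uniq val_inj) ?iota_uniq //.
move=> n; rewrite mem_iota; apply/mapP/idP => [[x + ->]|nv].
  by rewrite Wc inE /label /=; lia.
have nM : n < M by lia.
by exists (Ordinal nM) => //; rewrite Wc inE /label /=; lia.
Qed.

Lemma D_cycle_size c : is_cycle (undirected D) c -> size c = N.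
Proof.
move=> /[dup] -[_ Uc _] /D_cycle [/(cycle_labels _ Uc) /perm_size].
by rewrite size_map size_iota.
Qed.

(** The second route and the edge i -> j form the cycle of D, whose vertices,
    listed along the route, increase from i to j.  The cycle is thus
    v, v + 1, ..., v + N - 1 in this order, which determines its edges. *)
Lemma two_routes_chain (i j k : 'I_M) :
  D i j -> k != i -> connect D i k -> D k j ->
  forall x : 'I_M, v.+1 < label x < v + N ->
    C x = [set y : 'I_M | label y == (label x).-1].
Proof.
move=> dij ki /connectP [q pq lq] dkj x xv.
have q0 : 0 < size q by case: q pq lq ki => //= _ ->; rewrite eqxx.
set c := i :: rcons q j.
have pc : path D i (rcons q j) by rewrite rcons_path pq -lq dkj.
have sc : sorted ltn (map val c).
  by rewrite /= -/(map _ _) path_map; apply: sub_path pc => y z /D_up.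
have Uc : uniq c.
  by rewrite -(map_inj_uniq val_inj); move: sc; rewrite ltn_sorted_uniq_leq => /andP[].
have cycc : is_cycle (undirected D) c.
  split=> //; last by rewrite /= size_rcons ltnS.
  rewrite /= rcons_path last_rcons /undirected /= dij orbT andbT.
  by apply: sub_path pc => y z; rewrite /undirected /= => ->.
have [Wc Kc] := D_cycle c cycc.
have valc : map val c = iota v N.
  apply: (irr_sorted_eq ltn_trans ltnn) => //; first exact: iota_ltn_sorted.
  exact/perm_mem/cycle_labels.
have nextc (w : 'I_M) : v <= w < v + N ->
    val (next c w) = if w.+1 == v + N then v else w.+1.
  by move=> wv; rewrite -next_iota // -valc (next_map val_inj).
have Wmem (w : 'I_M) : (w \in c) = (v <= w < v + N) by rewrite Wc inE /label; lia.
apply/setP => z; rewrite inE /label /=; rewrite /label in xv.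
apply/idP/eqP => [zx|zx].
  have [_ z_x _] := C_edge _ _ zx.
  have: K z x by rewrite /K /undirected /= zx.
  rewrite Kc => /imsetP [w]; rewrite Wmem => wW /set2_eq.
  have := nextc w wW.
  move=> nw [] [/(congr1 val) zw /(congr1 val) xw]; 
    move: nw zw xw => /= ->; case: eqP; lia.
have zW : v <= z < v + N by lia.
have zx_next : next c z = x.
  by apply: val_inj; rewrite nextc //; case: eqP => //; lia.
have: K z x by rewrite Kc; apply/imsetP; exists z; rewrite ?Wmem // zx_next.
by case/orP=> // /C_edge []; lia.
Qed.

(** The first and the last vertex of the cycle have two neighbours on it.  The
    chain gives only one neighbour a + 1 to a, so the other one is b; and all
    edges of the cycle at b enter b, so one of them starts elsewhere than at a. *)
Lemma chain_chord (a b : 'I_M) : val a = v -> val b = (v + N).-1 ->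
  (forall i : 'I_M, v.+1 < label i < v + N ->
     C i = [set j : 'I_M | label j == (label i).-1]) ->
  a \in C b /\ exists2 y : 'I_M, y \in C b & a < y.
Proof.
move=> av bv chain; rewrite /= in av bv.
have [c [cycc Wc Kc]] := constr_C_cycle hD.
have nb := two_neighbours _ _ _ _ (undirected_sym _ _) cycc.
have [|y [z [yz ay az]]] := nb a; first by rewrite Wc inE /label; lia.
have a_out (w : 'I_M) : K a w -> a \in C w /\ (w = b \/ val w = v.+1).
  case/orP=> [aw|/C_edge []]; last by lia.
  split=> //; have [_ _ wv] := C_edge _ _ aw.
  have [->|wb] := eqVneq w b; [by left | right].
  have wl : v.+1 < label w < v + N.
    have [_ a_w _] := C_edge _ _ aw.
    by move: wb; rewrite -val_eqE /label /= in a_w *; lia.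
  by move: aw; rewrite (chain w wl) inE /label /= => /eqP; lia.
have ab : a \in C b.
  have [ay1 [<- //|yv]] := a_out y ay; have [az1 [<- //|zv]] := a_out z az.
  by move: yz; rewrite -val_eqE yv zv eqxx.
split=> //; have [|y' [z' [yz' bY bZ]]] := nb b.
  by rewrite Wc inE /label; lia.
have b_in (w : 'I_M) : K b w -> w \in C b.
  by case/orP=> // /C_edge []; lia.
have [yb zb] := (b_in y' bY, b_in z' bZ).
have [vy _ _] := C_edge _ _ yb; have [vz _ _] := C_edge _ _ zb.
have [ya|ya] := eqVneq y' a; last first.
  by exists y' => //; move: ya; rewrite -val_eqE /=; lia.
by exists z' => //; move: yz'; rewrite ya -val_eqE /=; lia.
Qed.

Lemma even_invertible : ~~ odd N -> invertible_digraph D.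
Proof.
move=> evN.
have [c /D_cycle_size -> //|f alt] := two_colouring _ _ D_irr (undirected_sym _ D).
apply: (invertible_of_signs _ _ f); apply: signed_inv_ge0_proper D_up _ _.
by move=> x y dxy; apply: alt; rewrite /undirected /= dxy.
Qed.

(** A cycle of D minus the chord would be the cycle of D, which uses the chord;
    so D minus the chord is acyclic and has a proper 2-colouring. *)
Lemma chain_invertible :
  (forall i : 'I_M, v.+1 < label i < v + N ->
     C i = [set j : 'I_M | label j == (label i).-1]) ->
  invertible_digraph D.
Proof.
move=> chain.
have vM : v < M by lia.
have bM : (v + N).-1 < M by lia.
pose a := Ordinal vM; pose b := Ordinal bM.
have [ab [y0 y0b ay0]] := chain_chord a b erefl erefl chain.
pose e := [rel x y | undirected D x y && ([set x; y] != [set a; b])].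
have sym_e : symmetric e.
  by move=> x y; rewrite /e /= undirected_sym setUC.
have irr_e : irreflexive e by move=> x; rewrite /e /= D_irr.
have acyclic c : is_cycle e c -> ~~ odd (size c).
  case=> cyc Uc sc; have sub : subrel e (undirected D) by move=> x y /andP[].
  have [_ Kc] := D_cycle c (And3 (sub_cycle sub cyc) Uc sc).
  have: K a b by rewrite /K /undirected /= ab.
  by rewrite Kc => /(cycle_edges_sub _ _ _ _ _ sym_e cyc) /andP [_]; rewrite eqxx.
have [f alt] := two_colouring _ e irr_e sym_e acyclic.
apply: (invertible_of_signs _ _ f).
apply: (signed_inv_ge0_chord _ _ D_up f a b).
- move=> x y dxy nab; apply: alt; rewrite /e /undirected /= dxy /=.
  apply/eqP => /set2_eq [[xa yb]|[xb ya]].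
    by rewrite xa yb eqxx in nab.
  by have := D_up _ _ dxy; rewrite xb ya /=; lia.
- move=> y yab; have yM : y.-1 < M by have := ltn_ord y; lia.
  rewrite /= in yab; exists (Ordinal yM) => /=; last by lia.
  by apply: C_sub_D; rewrite chain ?inE /label /=; lia.
- by exists y0; first exact: C_sub_D.
Qed.

Lemma odd_invertible_chain : odd N -> invertible_digraph D ->
  forall i : 'I_M, v.+1 < label i < v + N ->
    C i = [set j : 'I_M | label j == (label i).-1].
Proof.
move=> oddN /invertible_signs [f alt].
pose X := invmx (digraph_mx D).
have [/existsP [[i j] /= /andP [/C_sub_D ij Xij]]|] :=
    boolP [exists u : 'I_M * 'I_M, (u.1 \in C u.2) && (X u.1 u.2 != (-1)%R)].
  have [k [ki cik dkj]] := invmx_edge _ _ D_up _ _ ij Xij.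
  exact: two_routes_chain ij ki cik dkj.
rewrite negb_exists => /forallP all1.
have altC x y : x \in C y -> f y = ~~ f x.
  by move=> xy; apply: alt; have := all1 (x, y); rewrite /= xy negbK => /eqP.
have [c0 [[cyc0 Uc0 sz0] _ Kc0]] := constr_C_cycle hD.
have altK x y : K x y -> f y = ~~ f x.
  by case/orP=> /altC ->; rewrite ?negbK.
have := alternating_cycle_even _ _ _ _ altK cyc0.
rewrite (D_cycle_size c0) ?oddN //.
by split=> //; apply: sub_cycle cyc0; apply: K_sub_D.
Qed.

End Construction.

Theorem corollary4p16 (M N v : nat) (p t : seq nat) (C R : 'I_M -> {set 'I_M})
    (hNM : N < M) (hN : 3 <= N) (hv : 1 <= v <= M - N)
    (hD : construction N v p t C R) :
  invertible_digraph (digraph_D C R) <->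
  (~~ odd N \/
   forall i : 'I_M, v.+1 < label i < v + N ->
     C i = [set j : 'I_M | label j == (label i).-1]).
Proof.
have vNM : v + N <= M by lia.
split=> [inv|[evN|chain]].
- have [oddN|] := boolP (odd N); [right | by left].
  exact: odd_invertible_chain hN vNM hD oddN inv.
- exact: even_invertible hN vNM hD evN.
- exact: chain_invertible hN vNM hD chain.
Qed.
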